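(* The graph $G$ (defined in the context) is a connected 12-regular graph of order 42 and diameter 3 which is a $\{K_4\}_{42}^4\{K_{2,2,2}\}_{21}^3$-graph. Each vertex of $G$ is incident to exactly 3 copies of $K_{2,2,2}$ and exactly 4 copies of $K_4$.
   Context: The Fano plane $\mathcal F$ has points $1,\dots,7$ and lines $\{1,2,3\},\{1,4,5\},\{1,6,7\},\{2,4,6\},\{2,5,7\},\{3,4,7\},\{3,5,6\}$. For a point $p$, the three lines through $p$ are $\{p,q,r\}$ for three disjoint pairs $\{q,r\}$ partitioning $\mathcal F\setminus\{p\}$. An ordered pencil through $p$ is a tuple $v=(p,q_ar_a,q_br_b,q_cr_c)$ in which $q_ar_a,q_br_b,q_cr_c$ are these three (unordered) pairs listed in a chosen linear order (positions $a<b<c$); there are 6 ordered pencils through each point, 42 in total. The graph $G$ has the 42 ordered pencils as vertices, with $v=(p,q_ar_a,q_br_b,q_cr_c)$ and $v'=(p',q'_ar'_a,q'_br'_b,q'_cr'_c)$ adjacent iff $p\neq p'$ and $|\{q_i,r_i\}\cap\{q'_i,r'_i\}|=1$ for each $i\in\{a,b,c\}$. A ''copy of $H$'' in $G$ means an induced subgraph of $G$ isomorphic to $H$. For a connected regular graph $H$ and integers $1<m<n$, an $\{H\}_n^m$-graph is a connected graph that (a) is an edge-disjoint union of $n$ induced copies of $H$; (b) has exactly $m$ copies of $H$ containing each vertex, no two of which share more than one vertex; (c) has exactly $n$ induced subgraphs isomorphic to $H$. A graph is an $\{H_1\}_{n_1}^{m_1}\{H_2\}_{n_2}^{m_2}$-graph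 ($H_1\neq H_2$) if it is both an $\{H_1\}_{n_1}^{m_1}$-graph and an $\{H_2\}_{n_2}^{m_2}$-graph. $K_{2,2,2}$ is the octahedron graph. *)

(* Defs.v *)
From mathcomp Require Import all_boot.

Set Implicit Arguments.
Unset Strict Implicit.
Unset Printing Implicit Defensive.

Record sgraph := SGraph {
  svertex :> finType;
  sedge : rel svertex;
  sedge_sym : symmetric sedge;
  sedge_irrefl : irreflexive sedge
}.

Notation "x -- y" := (sedge x y) (at level 30).

Definition isomorphic (H K : sgraph) : bool :=
  [exists f : {ffun H -> K},
    [&& injectiveb f, [forall y, y \in codom f] &
        [forall x, forall y, (f x -- f y) == (x -- y)]]].

Section Induced.
Variables (G : sgraph) (A : {set G}).

Definition induced_edge : rel {x : G | x \in A} := fun x y => val x -- val y.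

Fact induced_edge_sym : symmetric induced_edge.
Proof. by move=> x y; exact: sedge_sym. Qed.

Fact induced_edge_irrefl : irreflexive induced_edge.
Proof. by move=> x; exact: sedge_irrefl. Qed.

Definition induced : sgraph := SGraph induced_edge_sym induced_edge_irrefl.
End Induced.

Definition connected (G : sgraph) : Prop :=
  0 < #|G| /\ forall x y : G, connect (@sedge G) x y.

Definition kregular (k : nat) (G : sgraph) : Prop :=
  forall x : G, #|[set y | x -- y]| = k.

Definition regular (G : sgraph) : Prop := exists k, kregular k G.

Definition has_walk (G : sgraph) (n : nat) (x y : G) : bool :=
  [exists t : n.-tuple G, path (@sedge G) x t && (last x t == y)].

(* Length of a shortest walk from x to y. A shortest walk has length < #|G|,
   and the value #|G| is the default for disconnected x and y. *)
Definition dist (G : sgraph) (x y : G) : nat :=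
  find (fun n => has_walk n x y) (iota 0 #|G|).

Definition diameter (G : sgraph) : nat := \max_(x : G) \max_(y : G) dist x y.

(* An induced subgraph is identified with its vertex set. *)
Definition copies (H G : sgraph) : {set {set G}} :=
  [set A : {set G} | isomorphic H (induced A)].

Definition copies_at (H G : sgraph) (v : G) : {set {set G}} :=
  [set A in copies H G | v \in A].

(* As the members of S are induced subgraphs, an edge x -- y belongs to A in S
   exactly when x and y are both in A. *)
Definition edge_disjoint_union_of_copies (H : sgraph) (n : nat) (G : sgraph) :
    Prop :=
  exists S : {set {set G}},
    [/\ #|S| = n,
        S \subset copies H G,
        cover S = [set: G],
        (forall x y : G, x -- y -> exists2 A, A \in S & (x \in A) && (y \in A)) &
        (forall A B, A \in S -> B \in S -> A != B ->
           forall x y : G, x -- y ->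
             ~~ [&& x \in A, y \in A, x \in B & y \in B])].

(* {H}_n^m-graphs *)
Record is_Hgraph (H : sgraph) (n m : nat) (G : sgraph) : Prop := IsHgraph {
  Hgraph_H_connected : connected H;
  Hgraph_H_regular : regular H;
  Hgraph_bounds : 1 < m < n;
  Hgraph_connected : connected G;
  Hgraph_union : edge_disjoint_union_of_copies H n G;
  Hgraph_copies_at : forall v : G, #|copies_at H v| = m;
  Hgraph_copies_meet : forall (v : G) (A B : {set G}),
    A \in copies_at H v -> B \in copies_at H v -> A != B -> #|A :&: B| <= 1;
  Hgraph_copies : #|copies H G| = n
}.

(* {H1}_n1^m1{H2}_n2^m2-graphs *)
Definition is_H1H2graph (H1 : sgraph) (n1 m1 : nat) (H2 : sgraph) (n2 m2 : nat)
    (G : sgraph) : Prop :=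
  [/\ ~~ isomorphic H1 H2, is_Hgraph H1 n1 m1 G & is_Hgraph H2 n2 m2 G].

Section Complete.
Variable n : nat.

Definition complete_edge : rel 'I_n := fun x y => x != y.

Fact complete_edge_sym : symmetric complete_edge.
Proof. by move=> x y; rewrite /complete_edge eq_sym. Qed.

Fact complete_edge_irrefl : irreflexive complete_edge.
Proof. by move=> x; rewrite /complete_edge eqxx. Qed.

Definition complete : sgraph := SGraph complete_edge_sym complete_edge_irrefl.
End Complete.

Section Octahedron.

(* (i, j) is the j-th vertex of the i-th part. *)
Definition octahedron_edge : rel ('I_3 * 'I_2) := fun x y => x.1 != y.1.

Fact octahedron_edge_sym : symmetric octahedron_edge.
Proof. by move=> x y; rewrite /octahedron_edge eq_sym. Qed.

Fact octahedron_edge_irrefl : irreflexive octahedron_edge.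
Proof. by move=> x; rewrite /octahedron_edge eqxx. Qed.

Definition K222 : sgraph := SGraph octahedron_edge_sym octahedron_edge_irrefl.
End Octahedron.

(* The ordinal x stands for the point labelled x.+1. *)
Notation point := 'I_7.

Definition fano_lines : seq {set point} :=
  [seq [set x : point | x.+1 \in l] |
    l <- [:: [:: 1; 2; 3]; [:: 1; 4; 5]; [:: 1; 6; 7]; [:: 2; 4; 6];
             [:: 2; 5; 7]; [:: 3; 4; 7]; [:: 3; 5; 6]]].

(* The pairs {q, r} such that {p, q, r} is a line *)
Definition pencil (p : point) : seq {set point} :=
  [seq l :\ p | l : {set point} <- fano_lines & p \in l].

(* (p, [q_a r_a; q_b r_b; q_c r_c]), the positions a < b < c being 0 < 1 < 2 *)
Definition ordered_pencil :=
  {v : point * 3.-tuple {set point} | perm_eq v.2 (pencil v.1)}.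

Definition op_point (v : ordered_pencil) : point := (val v).1.
Definition op_pair (v : ordered_pencil) (i : 'I_3) : {set point} :=
  tnth (val v).2 i.

Definition G_edge : rel ordered_pencil := fun v w =>
  (op_point v != op_point w) &&
  [forall i : 'I_3, #|op_pair v i :&: op_pair w i| == 1].

Fact G_edge_sym : symmetric G_edge.
Proof.
move=> v w; rewrite /G_edge eq_sym; congr (_ && _).
by apply: eq_forallb => i; rewrite setIC.
Qed.

Fact G_edge_irrefl : irreflexive G_edge.
Proof. by move=> v; rewrite /G_edge eqxx. Qed.

Definition G : sgraph := SGraph G_edge_sym G_edge_irrefl.

(* Main.v *)
(** Let [v], [w] be adjacent ordered pencils through [p] and [q].  The common
    points [x_i] of their [i]-th pairs form a line, so the edge lies in the clique
    of the four pencils whose [i]-th pair contains [x_i] for every [i]: this gives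
    one clique for each of the 42 ordered lines.  Also, the line [l] through [p]
    and [q] has the same position [i] in [v] and in [w], so the edge lies in the
    octahedron of the six pencils whose point is on [l] and whose [i]-th pair is
    [l] minus that point: this gives 7 * 3 = 21 octahedra.  That no other copies
    exist, and all the counts, are verified by enumerating the 42 pencils as
    lists of labels in 1, ..., 7. *)
Require Import Defs.
From mathcomp Require Import all_boot.

Set Implicit Arguments.
Unset Strict Implicit.
Unset Printing Implicit Defensive.

(** * Induced copies and [{H}_n^m]-graphs *)

Lemma isomorphic_card (H K : sgraph) : isomorphic H K -> #|H| = #|K|.
Proof.
case/existsP=> f /and3P[/injectiveP f_inj /forallP f_onto _].
by rewrite -(card_codom f_inj); apply: eq_card => y; rewrite f_onto.
Qed.

(** Composing with [val] turns an isomorphism onto [induced A] into an embedding into [K] with image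
    [A], which removes the subtype from later arguments. *)
Lemma isomorphic_inducedP (H K : sgraph) (A : {set K}) :
  reflect (exists2 g : H -> K, injective g /\ A = [set g x | x : H] &
             forall x y, g x -- g y = x -- y)
          (isomorphic H (induced A)).
Proof.
apply: (iffP existsP) => [[f /and3P[/injectiveP f_inj /forallP f_onto]]|].
  move=> /forallP f_edge; exists (fun x => val (f x)); last first.
    by move=> x y; rewrite -(eqP (forallP (f_edge x) y)).
  split=> [x y /val_inj /f_inj //|].
  apply/setP => v; apply/idP/imsetP => [vA | [x _ ->]]; last exact: (valP (f x)).
  have /codomP[x fx] := f_onto (Sub v vA).
  by exists x => //; rewrite -fx.
case=> g [g_inj ->] g_edge.
have gA x : g x \in [set g x | x : H] by apply: imset_f.
exists [ffun x => Sub (g x) (gA x)]; apply/and3P; split.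
- by apply/injectiveP => x y; rewrite !ffunE => /(congr1 val) /= /g_inj.
- apply/forallP => -[v vA]; have /imsetP[x _ def_v] := vA.
  by apply/codomP; exists x; apply: val_inj; rewrite ffunE /=.
- apply/forallP => x; apply/forallP => y; rewrite !ffunE.
  by rewrite -(g_edge x y).
Qed.

(** The family of all copies serves as the edge-disjoint union: it covers [K] because [m] is
    positive, and two copies sharing an edge would share both of its ends. *)
Lemma is_Hgraph_intro (H K : sgraph) (n m : nat) :
    connected H -> regular H -> 1 < m < n -> connected K ->
    (forall x y : K, x -- y ->
       exists2 A, A \in copies H K & (x \in A) && (y \in A)) ->
    (forall v : K, #|copies_at H v| = m) ->
    (forall A B : {set K}, A \in copies H K -> B \in copies H K -> A != B ->
       #|A :&: B| <= 1) ->
    #|copies H K| = n ->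
  is_Hgraph H n m K.
Proof.
move=> Hconn Hreg mn Kconn Kedge Kat Kmeet Kcard; split=> //; last first.
  by move=> v A B; rewrite !inE => /andP[? _] /andP[? _]; apply: Kmeet; rewrite inE.
exists (copies H K); split=> //.
- apply/setP => v; rewrite inE; apply/bigcupP.
  have /card_gt0P[A] : 0 < #|copies_at H v|.
    by rewrite Kat ltnW //; case/andP: mn.
  by rewrite inE => /andP[AS vA]; exists A.
- move=> A B AS BS neqAB x y xy; apply/negP => /and4P[xA yA xB yB].
  have := Kmeet A B AS BS neqAB; rewrite leqNgt => /negP; apply.
  (* Removing [x] and then [y] counts two elements of the intersection; they differ because an edge
     is not a loop. *)
  rewrite (cardD1 x) (cardD1 y) !inE xA yA xB yB /= andbT.
  by case: eqP => // yx; rewrite yx sedge_irrefl in xy.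
Qed.

(** * Connectedness and regularity of complete graphs and the octahedron *)

Lemma complete_connected (n : nat) : 0 < n -> connected (complete n).
Proof.
move=> n_gt0; split; first by rewrite card_ord.
move=> x y; have [-> | neq_xy] := eqVneq x y; first exact: connect0.
exact: connect1.
Qed.

Lemma complete_regular (n : nat) : kregular n.-1 (complete n).
Proof.
move=> x; rewrite -[in RHS](card_ord n) -(cardsC1 x).
by apply: eq_card => y; rewrite !inE eq_sym.
Qed.

Lemma K222_connected : connected K222.
Proof.
split; first by rewrite card_prod !card_ord.
move=> x y; have [eq_xy | neq_xy] := eqVneq x.1 y.1; last exact: connect1.
(* Two vertices of one part are joined by a path through another part [i]. *)
have [i neq_ix] : exists i : 'I_3, i != x.1.
  case: (eqVneq ord0 x.1) => [<- |]; last by exists ord0.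
  by exists ord_max.
apply: (@connect_trans _ _ ((i, ord0) : K222)); apply: connect1.
  by rewrite /= /octahedron_edge eq_sym.
by rewrite /= /octahedron_edge -eq_xy.
Qed.

Lemma K222_regular : kregular 4 K222.
Proof.
move=> x.
have -> : [set y : K222 | x -- y] = setX [set~ x.1] [set: 'I_2].
  by apply/setP => y; rewrite !inE /= /octahedron_edge eq_sym andbT.
by rewrite cardsX cardsC1 cardsT !card_ord.
Qed.

(** * Walks by recursion on their length *)

Lemma has_walk0 (K : sgraph) (x y : K) : has_walk 0 x y = (x == y).
Proof.
apply/existsP/eqP => [[t] | ->]; first by rewrite tuple0 => /eqP.
by exists [tuple]; rewrite /= eqxx.
Qed.

Lemma has_walkS (K : sgraph) (n : nat) (x y : K) :
  has_walk n.+1 x y = [exists z, x -- z && has_walk n z y].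
Proof.
apply/existsP/existsP => [[t] | [z /andP[xz /existsP[t ty]]]].
  case/tupleP: t => z t /= /andP[/andP[xz zt] ty].
  by exists z; rewrite xz; apply/existsP; exists t; rewrite zt.
by exists [tuple of z :: t]; rewrite /= xz.
Qed.

Lemma has_walk_connect (K : sgraph) (n : nat) (x y : K) :
  has_walk n x y -> connect (@sedge K) x y.
Proof. by case/existsP=> t /andP[xt /eqP <-]; apply/connectP; exists t. Qed.

(** * Ordered pencils as lists of labels *)

Lemma card_ord_count (n : nat) (P : pred nat) :
  #|[set i : 'I_n | P i]| = count P (iota 0 n).
Proof.
by rewrite cardsE cardE {1}/enum_mem size_filter -enumT -val_enum_ord count_map.
Qed.

Definition fano_triples : seq (seq nat) :=
  [:: [:: 1; 2; 3]; [:: 1; 4; 5]; [:: 1; 6; 7]; [:: 2; 4; 6];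
      [:: 2; 5; 7]; [:: 3; 4; 7]; [:: 3; 5; 6]].

Definition pencil_labels (p : nat) : seq (seq nat) :=
  [seq [seq x <- l | x != p] | l <- fano_triples & p \in l].

Definition label_set (s : seq nat) : {set point} := [set x : point | x.+1 \in s].

(** Filtering [iota 1 7] makes the list increasing, so equal sets have equal lists. *)
Definition labels (A : {set point}) : seq nat :=
  [seq x <- iota 1 7 | [exists y in A, x == (y : point).+1]].

Lemma label_iota (x : point) : x.+1 \in iota 1 7.
Proof. by rewrite mem_iota; apply: (ltn_ord x). Qed.

Lemma mem_labels (A : {set point}) (x : point) :
  (x.+1 \in labels A) = (x \in A).
Proof.
rewrite mem_filter label_iota andbT.
apply/existsP/idP => [[y /andP[yA /eqP[/ord_inj ->]]] // | xA].
by exists x; rewrite xA /=.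
Qed.

Lemma labelsK : cancel labels label_set.
Proof. by move=> A; apply/setP => x; rewrite inE mem_labels. Qed.

Lemma label_setK (s : seq nat) :
  s = [seq x <- iota 1 7 | x \in s] -> labels (label_set s) = s.
Proof.
move=> def_s; rewrite [RHS]def_s; apply: eq_in_filter => x.
rewrite mem_iota => /andP[x_gt0 x_lt].
have x_lt7 : x.-1 < 7 by rewrite -ltnS prednK.
apply/existsP/idP => [[y /andP[]] | xs].
  by rewrite inE => ys /eqP ->.
by exists (Ordinal x_lt7); rewrite inE /= prednK // xs eqxx.
Qed.

Lemma label_setI_card (A B : {set point}) :
  #|A :&: B| = count [pred x | (x \in labels A) && (x \in labels B)] (iota 1 7).
Proof.
rewrite -[iota 1 7]/(map succn (iota 0 7)) count_map -card_ord_count.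
by apply: eq_card => x; rewrite !inE /= !mem_labels.
Qed.

Lemma pencilE (p : point) : pencil p = map label_set (pencil_labels p.+1).
Proof.
rewrite /pencil /fano_lines filter_map -!map_comp.
rewrite -[X in filter _ X]/fano_triples.
under eq_filter => l do rewrite /= inE.
apply: eq_map => l /=; apply/setP => x.
by rewrite !inE mem_filter eqSS.
Qed.

Lemma pencil_labelsK (p : point) :
  map labels (pencil p) = pencil_labels p.+1.
Proof.
rewrite pencilE -map_comp; apply: map_id_in => s s_p.
apply: label_setK; apply/eqP.
(* All pairs in the seven pencils are listed in increasing order. *)
have : all (fun q => all (fun t : seq nat => t == [seq x <- iota 1 7 | x \in t])
                         (pencil_labels q)) (iota 1 7) by vm_compute.
by move/allP/(_ _ (label_iota p))/allP; apply.
Qed.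

Definition codes : seq (nat * seq (seq nat)) :=
  [seq (p, o) | p <- iota 1 7, o <- permutations (pencil_labels p)].

Definition code (v : G) : nat * seq (seq nat) :=
  ((op_point v).+1, map labels (val v).2).

Lemma code_inj : injective code.
Proof.
move=> [[p s] vP] [[q t] wP] [] /= eq_p /(inj_map (can_inj labelsK)) eq_s.
by apply: val_inj; congr (_, _); [apply: ord_inj | apply: val_inj].
Qed.

Lemma mem_codes (c : nat * seq (seq nat)) :
  reflect (exists v, code v = c) (c \in codes).
Proof.
apply: (iffP allpairsPdep) => [[p [o [p_7]]] | [v <-]].
  rewrite mem_permutations mem_iota in p_7 * => o_p ->.
  case/andP: p_7 => p_gt0; rewrite add1n => p_le.
  have p_lt : p.-1 < 7 by rewrite -ltnS prednK.
  pose x : point := Ordinal p_lt.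
  have x_p : x.+1 = p by rewrite /= prednK.
  have sz_o : size (map label_set o) == 3.
    rewrite size_map (perm_size o_p).
    have : all (fun q => size (pencil_labels q) == 3) (iota 1 7) by vm_compute.
    by move/allP; apply; rewrite mem_iota p_gt0 add1n.
  have v_ok : perm_eq (Tuple sz_o) (pencil x).
    by rewrite pencilE x_p; apply: perm_map.
  exists (Sub (x, Tuple sz_o) v_ok).
  rewrite /code /op_point /= prednK //; congr (_, _).
  rewrite -map_comp; apply: map_id_in => s s_o.
  (* Entries of [o] have the form [labels A], and on such lists [label_set] followed by [labels] is
     the identity. *)
  have : s \in map labels (pencil x).
    by rewrite pencil_labelsK x_p -(perm_mem o_p).
  by case/mapP=> A _ ->; rewrite /= labelsK.
exists (op_point v).+1, (map labels (val v).2); split=> //; first exact: label_iota.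
by rewrite mem_permutations -pencil_labelsK; apply/perm_map/(valP v).
Qed.

Definition adj_code (c d : nat * seq (seq nat)) : bool :=
  (c.1 != d.1) &&
  all (fun i => count [pred x | (x \in nth [::] c.2 i) && (x \in nth [::] d.2 i)]
                      (iota 1 7) == 1) (iota 0 3).

Lemma edge_code (v w : G) : v -- w = adj_code (code v) (code w).
Proof.
rewrite -[LHS]/(G_edge v w) /G_edge /adj_code; congr (~~ _ && _) => //.
have nthE (u : G) (i : 'I_3) : nth [::] (map labels (val u).2) i = labels (op_pair u i).
  by rewrite (nth_map set0) ?size_tuple // /op_pair (tnth_nth set0).
apply/forallP/allP => [vw i | vw i].
  rewrite mem_iota => /= i_lt; have := vw (Ordinal i_lt).
  by rewrite label_setI_card -!nthE.
have := vw i; rewrite mem_iota ltn_ord => /(_ isT).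
by rewrite label_setI_card -!nthE.
Qed.

(** * Vertices as numbers below 42 *)

Definition idx (v : G) : nat := index (code v) codes.

Lemma size_codes : size codes = 42.
Proof. by vm_compute. Qed.

Lemma idx_lt (v : G) : idx v < 42.
Proof. by rewrite -size_codes index_mem; apply/mem_codes; exists v. Qed.

Lemma nth_idx (v : G) : nth (0, [::]) codes (idx v) = code v.
Proof. by apply: nth_index; apply/mem_codes; exists v. Qed.

Lemma idx_inj : injective idx.
Proof. by move=> v w eq_vw; apply: code_inj; rewrite -!nth_idx eq_vw. Qed.

(** Every code comes from a pencil, and [codes] has no repetition, so the pencil with the [i]-th
    code has number [i]. *)
Lemma idx_onto (i : nat) : i < 42 -> exists v, idx v == i.
Proof.
rewrite -size_codes => i_lt.
have /mem_codes[v def_v] := mem_nth (0, [::]) i_lt.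
exists v; rewrite /idx def_v index_uniq //; by vm_compute.
Qed.

Definition vtx (i : 'I_42) : G := xchoose (idx_onto (ltn_ord i)).

Lemma vtxK (i : 'I_42) : idx (vtx i) = i.
Proof. exact/eqP/(xchooseP (idx_onto (ltn_ord i))). Qed.

Lemma idxK (v : G) : vtx (Ordinal (idx_lt v)) = v.
Proof. by apply: idx_inj; rewrite vtxK. Qed.

(** The bijection [vtx] turns cardinals of vertex sets into counts that can be computed. *)
Lemma card_idx (P : pred nat) : #|[set v : G | P (idx v)]| = count P (iota 0 42).
Proof.
have vtx_inj : injective vtx.
  by move=> i j /(congr1 idx); rewrite !vtxK => /ord_inj.
rewrite -card_ord_count -(card_imset _ vtx_inj); apply: eq_card => v.
rewrite inE; apply/idP/imsetP => [Pv | [i]].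
  by exists (Ordinal (idx_lt v)); rewrite ?inE ?idxK.
by rewrite inE => Pi ->; rewrite vtxK.
Qed.

(** Tabulated adjacency: the exhaustive checks below look up neighbours instead of comparing
    codes. *)
Definition nbrs_table : seq (seq nat) :=
  [seq [seq j <- iota 0 42 | adj_code (nth (0, [::]) codes i) (nth (0, [::]) codes j)]
     | i <- iota 0 42].

Definition nbrs (i : nat) : seq nat := nth [::] nbrs_table i.

Lemma edge_idx (v w : G) : v -- w = (idx w \in nbrs (idx v)).
Proof.
rewrite /nbrs (nth_map 0) ?size_iota ?idx_lt // nth_iota ?idx_lt //.
by rewrite mem_filter mem_iota leq0n !add0n idx_lt !andbT !nth_idx edge_code.
Qed.

Lemma all_idx (P : pred nat) (v : G) : all P (iota 0 42) -> P (idx v).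
Proof. by move/allP; apply; rewrite mem_iota idx_lt. Qed.

(** * Order, degree, connectedness and diameter of [G] *)

Lemma G_card : #|G| = 42.
Proof. by rewrite -[42]/(count predT (iota 0 42)) -card_idx cardsE. Qed.

Lemma G_regular : kregular 12 G.
Proof.
move=> v.
have -> : [set w | v -- w] = [set w : G | idx w \in nbrs (idx v)].
  by apply/setP => w; rewrite !inE -edge_idx.
have : all (fun i => count [in nbrs i] (iota 0 42) == 12) (iota 0 42) by vm_compute.
by move/(all_idx v)/eqP => <-; rewrite -card_idx.
Qed.

Fixpoint walk_idx (n i j : nat) : bool :=
  if n is n'.+1 then has (fun k => walk_idx n' k j) (nbrs i) else i == j.

Lemma has_walk_idx (n : nat) (v w : G) :
  has_walk n v w = walk_idx n (idx v) (idx w).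
Proof.
elim: n v => [|n IHn] v; first by rewrite has_walk0 /= (inj_eq idx_inj).
rewrite has_walkS [RHS]/=; apply/existsP/hasP => [[u /andP[]] | [k k_v k_w]].
  by rewrite edge_idx IHn => u_v u_w; exists (idx u).
have k_lt : k < 42.
  move: k_v; rewrite /nbrs (nth_map 0) ?size_iota ?idx_lt //.
  by rewrite mem_filter mem_iota => /and3P[].
exists (vtx (Ordinal k_lt)).
by rewrite edge_idx IHn vtxK k_v.
Qed.

Lemma dist_idx (v w : G) :
  dist v w = find (fun n => walk_idx n (idx v) (idx w)) (iota 0 42).
Proof. by rewrite /dist G_card; apply: eq_find => n; rewrite has_walk_idx. Qed.

(** Checked on all pairs of numbers; [find] stops at the first length that works, so no walk longer
    than 3 is tried. *)
Lemma dist_le3 (v w : G) : dist v w <= 3.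
Proof.
have : all (fun i => all (fun j =>
    find (fun n => walk_idx n i j) (iota 0 42) <= 3) (iota 0 42)) (iota 0 42).
  by vm_compute.
by move/(all_idx v)/(all_idx w); rewrite dist_idx.
Qed.

Lemma G_connected : connected G.
Proof.
split=> [|v w]; first by rewrite G_card.
(* A distance below the default value [#|G|] means that the search has found a walk. *)
have : has (fun n => has_walk n v w) (iota 0 #|G|).
  rewrite has_find size_iota -[X in X < _]/(dist v w) G_card.
  by rewrite (leq_ltn_trans (dist_le3 v w)).
by case/hasP=> n _; apply: has_walk_connect.
Qed.

Lemma G_diameter : diameter G = 3.
Proof.
apply/eqP; rewrite eqn_leq; apply/andP; split.
  by apply/bigmax_leqP => v _; apply/bigmax_leqP => w _; apply: dist_le3.
(* The first number out of reach of vertex 0 by walks of length below 3; [j_lt] rules out the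
   default 42 of a failed search. *)
pose j := find (fun j => ~~ has (fun n => walk_idx n 0 j) (iota 0 3)) (iota 0 42).
have j_lt : j < 42 by vm_compute.
pose v := vtx ord0; pose w := vtx (Ordinal j_lt).
apply: leq_trans (leq_bigmax v); apply: leq_trans (leq_bigmax w).
by rewrite dist_idx !vtxK; vm_compute.
Qed.

(** * Copies of [K_4] and of the octahedron *)

Definition idx_set (s : seq nat) : {set G} := [set v | idx v \in s].

(* The lists in [L] are normalised to be increasing, so that [idx_set] is
   injective on [L]. *)
Definition linear_system (L : seq (seq nat)) (k n m : nat) : bool :=
  [&& [&& uniq L, size L == n &
         all (fun s : seq nat => (s == [seq i <- iota 0 42 | i \in s]) && (size s == k)) L],
      all (fun i => count (fun s : seq nat => i \in s) L == m) (iota 0 42),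
      all (fun i => all (fun j => has (fun s : seq nat => (i \in s) && (j \in s)) L) (nbrs i))
          (iota 0 42) &
      all (fun s : seq nat => all (fun t : seq nat => (s == t) || (count [in t] s <= 1)) L) L].

(** Reading a block at the positions [r x] embeds [H] onto it, so blocks are copies. Conversely each
    embedded copy lies in a block, and equal cardinality makes it the whole block. So the copies are
    exactly the blocks, and [linear_system] supplies the counts. *)
Lemma is_Hgraph_linear_system (H : sgraph) (r : H -> nat) (L : seq (seq nat))
    (n m : nat) :
    connected H -> regular H -> 1 < m < n -> linear_system L #|H| n m ->
    injective r -> (forall x, r x < #|H|) ->
    (forall s x y, s \in L ->
       (nth 0 s (r y) \in nbrs (nth 0 s (r x))) = x -- y) ->
    (forall g : H -> G, injective g -> (forall x y, g x -- g y = x -- y) ->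
       exists2 s, s \in L & forall x, idx (g x) \in s) ->
  is_Hgraph H n m G.
Proof.
move=> Hconn Hreg mn.
case/and4P=> /and3P[L_uniq /eqP L_size L_norm] L_at L_edge L_meet r_inj r_lt L_emb L_all.
have normE s : s \in L -> s = [seq i <- iota 0 42 | i \in s].
  by move/(allP L_norm)/andP => -[/eqP].
have card_L s : s \in L -> #|idx_set s| = #|H|.
  move=> sL; rewrite (card_idx [in s]) -size_filter -normE //.
  by case/andP: (allP L_norm s sL) => _ /eqP.
have lt_L s i : s \in L -> i \in s -> i < 42.
  by move/normE=> ->; rewrite mem_filter mem_iota => /and3P[].
have copiesE : copies H G = [set A in map idx_set L].
  apply/setP => A; rewrite !inE; apply/isomorphic_inducedP/mapP.
    case=> g [g_inj ->] g_edge; have [s sL g_s] := L_all g g_inj g_edge.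
    exists s => //; apply/eqP; rewrite eqEcard card_L // card_imset // leqnn andbT.
    by apply/subsetP => _ /imsetP[x _ ->]; rewrite inE.
  case=> s sL ->; pose e x := nth 0 s (r x).
  have size_s : size s = #|H| by case/andP: (allP L_norm s sL) => _ /eqP.
  have e_s x : e x \in s by rewrite mem_nth // size_s.
  have s_uniq : uniq s by rewrite (normE s sL) filter_uniq // iota_uniq.
  have e_inj : injective e.
    by move=> x y /eqP; rewrite nth_uniq ?size_s // => /eqP /r_inj.
  have e_lt x : e x < 42 := lt_L s (e x) sL (e_s x).
  pose g x := vtx (Ordinal (e_lt x)).
  have g_inj : injective g by move=> x y /(congr1 idx); rewrite !vtxK => /e_inj.
  exists g; last by move=> x y; rewrite edge_idx !vtxK L_emb.
  split=> //; apply/esym/eqP; rewrite eqEcard card_L // card_imset // leqnn andbT.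
  by apply/subsetP => _ /imsetP[x _ ->]; rewrite inE vtxK e_s.
have idx_set_inj : {in L &, injective idx_set}.
  move=> s t sL tL eq_st; rewrite (normE s sL) (normE t tL).
  apply: eq_in_filter => i; rewrite mem_iota => i_lt.
  (* Membership of the vertex numbered [i] in the two sets is membership of [i] in the two lists. *)
  have := congr1 (fun A : {set G} => vtx (Ordinal i_lt) \in A) eq_st.
  by rewrite !inE vtxK.
have S_uniq : uniq (map idx_set L) by rewrite map_inj_in_uniq.
apply: is_Hgraph_intro => //; first exact: G_connected.
- move=> v w; rewrite edge_idx => w_v; have := all_idx v L_edge.
  move/allP/(_ _ w_v)/hasP => [s sL s_vw]; exists (idx_set s); last by rewrite !inE.
  by rewrite copiesE inE map_f.
- move=> v; have /eqP <- := all_idx v L_at.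
  rewrite /copies_at copiesE -size_filter.
  have -> : [set A in [set A in map idx_set L] | v \in A] =
            [set A in map idx_set [seq s <- L | idx v \in s]].
    apply/setP => A; rewrite !inE; apply/andP/mapP => [[/mapP[s sL ->]] | [s]].
      by rewrite inE => s_v; exists s; rewrite // mem_filter s_v.
    by rewrite mem_filter => /andP[s_v sL] ->; rewrite inE map_f.
  rewrite cardsE; rewrite (card_uniqP _) ?size_map //.
  rewrite map_inj_in_uniq ?filter_uniq // => s t.
  by rewrite !mem_filter => /andP[_ ?] /andP[_ ?]; apply: idx_set_inj.
- move=> A B; rewrite copiesE !inE => /mapP[s sL ->] /mapP[t tL ->] neq_st.
  have /orP[/eqP eq_st | le1] := allP (allP L_meet s sL) t tL.
    by rewrite eq_st eqxx in neq_st.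
  have -> : idx_set s :&: idx_set t = [set v | idx v \in [seq i <- s | i \in t]].
    by apply/setP => v; rewrite !inE mem_filter andbC.
  rewrite (card_idx [in [seq i <- s | i \in t]]).
  move: le1; rewrite [in X in X -> _](normE s sL) count_filter.
  congr (_ <= _); apply: eq_count => i.
  by rewrite /= mem_filter.
- by rewrite copiesE cardsE (card_uniqP _) // size_map.
Qed.

Definition K4_list : seq (seq nat) :=
  [seq [seq k <- iota 0 42 |
          all (fun i => nth 0 x i \in nth [::] (nth (0, [::]) codes k).2 i) (iota 0 3)]
     | l <- fano_triples, x <- permutations l].

(** Since [codes] is grouped by point, the two pencils of a block with the same point, which are
    antipodal, are consecutive; hence position [2i + j] for the vertex [(i, j)]. *)
Definition octahedron_list : seq (seq nat) :=
  [seq [seq k <- iota 0 42 |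
          let c := nth (0, [::]) codes k in
          (c.1 \in l) && (nth [::] c.2 i == [seq x <- l | x != c.1])]
     | l <- fano_triples, i <- iota 0 3].

(** Exhaustive search, with each new vertex drawn only from the common neighbours of the earlier
    ones. *)
Lemma K4_list_complete (a b c d : nat) :
    a < 42 -> b \in nbrs a ->
    (c \in nbrs a) && (c \in nbrs b) ->
    [&& d \in nbrs a, d \in nbrs b & d \in nbrs c] ->
  exists2 s, s \in K4_list & all [in s] [:: a; b; c; d].
Proof.
move=> a_lt b_N /andP[c_a c_b] /and3P[d_a d_b d_c].
have : all (fun a => all (fun b => all (fun c => all (fun d =>
    has (fun s => all [in s] [:: a; b; c; d]) K4_list)
    [seq d <- nbrs c | (d \in nbrs a) && (d \in nbrs b)])
    [seq c <- nbrs b | c \in nbrs a]) (nbrs a)) (iota 0 42).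
  by vm_compute.
move/allP/(_ a); rewrite mem_iota => /(_ a_lt) /allP/(_ b b_N) /allP/(_ c).
rewrite mem_filter c_a c_b => /(_ isT) /allP/(_ d).
by rewrite mem_filter d_a d_b d_c => /(_ isT) /hasP.
Qed.

(** Primes denote antipodes. The search fixes a triangle [a], [b], [c] and then extends it by
    antipodes, which must be stated distinct since a vertex is not adjacent to itself either. *)
Lemma octahedron_list_complete (a a' b b' c c' : nat) :
    a < 42 -> b \in nbrs a ->
    (c \in nbrs a) && (c \in nbrs b) ->
    [&& a' \in nbrs b, a' \in nbrs c, a' != a & a' \notin nbrs a] ->
    [&& b' \in nbrs a, b' \in nbrs c, b' \in nbrs a', b' != b & b' \notin nbrs b] ->
    [&& c' \in nbrs a, c' \in nbrs b, c' \in nbrs a', c' \in nbrs b', c' != c &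
        c' \notin nbrs c] ->
  exists2 s, s \in octahedron_list & all [in s] [:: a; a'; b; b'; c; c'].
Proof.
move=> a_lt b_N /andP[c_a c_b] /andP[a'_b a'_P] /andP[b'_a b'_P] /andP[c'_a c'_P].
have : all (fun a => all (fun b => all (fun c => all (fun a' =>
    all (fun b' => all (fun c' =>
    has (fun s => all [in s] [:: a; a'; b; b'; c; c']) octahedron_list)
    [seq c' <- nbrs a | [&& c' \in nbrs b, c' \in nbrs a', c' \in nbrs b',
                            c' != c & c' \notin nbrs c]])
    [seq b' <- nbrs a | [&& b' \in nbrs c, b' \in nbrs a', b' != b & b' \notin nbrs b]])
    [seq a' <- nbrs b | [&& a' \in nbrs c, a' != a & a' \notin nbrs a]])
    [seq c <- nbrs b | c \in nbrs a]) (nbrs a)) (iota 0 42).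
  by vm_compute.
move/allP/(_ a); rewrite mem_iota => /(_ a_lt) /allP/(_ b b_N) /allP/(_ c).
rewrite mem_filter c_a c_b => /(_ isT) /allP/(_ a').
rewrite mem_filter a'_b a'_P => /(_ isT) /allP/(_ b').
rewrite mem_filter b'_a b'_P => /(_ isT) /allP/(_ c').
by rewrite mem_filter c'_a c'_P => /(_ isT) /hasP.
Qed.

Lemma G_K4 : is_Hgraph (complete 4) 42 4 G.
Proof.
apply: (@is_Hgraph_linear_system (complete 4) (fun i : 'I_4 => val i) K4_list) => //.
- exact: complete_connected.
- by exists 3; apply: complete_regular.
- by rewrite card_ord; vm_compute.
- exact: val_inj.
- by move=> x; rewrite card_ord; apply: ltn_ord.
- move=> s x y sL.
  have : all (fun s => all (fun i => all (fun j =>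
      (nth 0 s j \in nbrs (nth 0 s i)) == (i != j)) (iota 0 4)) (iota 0 4)) K4_list.
    by vm_compute.
  move/allP/(_ s sL)/allP/(_ (val x)); rewrite mem_iota ltn_ord => /(_ isT).
  by move/allP/(_ (val y)); rewrite mem_iota ltn_ord => /(_ isT)/eqP.
move=> g _ g_edge.
(* Indexing by [nat] lets the four vertices be named by numerals. *)
have [t tE] : exists t : nat -> nat, forall x : 'I_4, idx (g x) = t x.
  by exists (fun k => idx (g (inord k))) => x; rewrite inord_val.
have t_edge i j : i < 4 -> j < 4 -> (t j \in nbrs (t i)) = (i != j).
  move=> i_lt j_lt; rewrite -(tE (Ordinal i_lt)) -(tE (Ordinal j_lt)).
  by rewrite -edge_idx g_edge.
have t0_lt : t 0 < 42 by rewrite -(tE ord0) idx_lt.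
case: (@K4_list_complete (t 0) (t 1) (t 2) (t 3)); rewrite ?t_edge //.
move=> s sL /allP t_s; exists s => // x; rewrite tE; apply: t_s.
by apply: (map_f t (s := iota 0 4)); rewrite mem_iota ltn_ord.
Qed.

Lemma G_K222 : is_Hgraph K222 21 3 G.
Proof.
apply: (@is_Hgraph_linear_system K222 (fun x => x.1.*2 + x.2) octahedron_list) => //.
- exact: K222_connected.
- by exists 4; apply: K222_regular.
- by rewrite card_prod !card_ord; vm_compute.
- move=> [i j] [i' j'] /= eq_ij.
  (* As [j < 2], halving recovers [i], and cancellation then gives [j]. *)
  have : (i.*2 + j)./2 = (i'.*2 + j')./2 by rewrite eq_ij.
  have half_r (k : nat) (l : 'I_2) : (k.*2 + l)./2 = k.
    by case: l => -[|[|//]] ?; rewrite /= ?addn0 ?addn1 /= ?doubleK ?uphalf_double.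
  rewrite !half_r => /ord_inj eq_i; move: eq_ij; rewrite eq_i => /addnI /ord_inj.
  by move->.
- move=> [i j]; rewrite card_prod !card_ord /=.
  by case: i => -[|[|[|//]]] ?; case: j => -[|[|//]].
- move=> s [i j] [i' j'] sL.
  have : all (fun s => all (fun i => all (fun j => all (fun i' => all (fun j' =>
      (nth 0 s (i'.*2 + j') \in nbrs (nth 0 s (i.*2 + j))) == (i != i'))
      (iota 0 2)) (iota 0 3)) (iota 0 2)) (iota 0 3)) octahedron_list.
    by vm_compute.
  move/allP/(_ s sL)/allP/(_ (val i)); rewrite mem_iota ltn_ord => /(_ isT).
  move/allP/(_ (val j)); rewrite mem_iota ltn_ord => /(_ isT).
  move/allP/(_ (val i')); rewrite mem_iota ltn_ord => /(_ isT).
  by move/allP/(_ (val j')); rewrite mem_iota ltn_ord => /(_ isT)/eqP.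
move=> g g_inj g_edge.
have [t tE] : exists t : nat -> nat -> nat,
    forall (i : 'I_3) (j : 'I_2), idx (g (i, j)) = t i j.
  by exists (fun i j => idx (g (inord i, inord j))) => i j; rewrite !inord_val.
have t_edge i j i' j' : i < 3 -> j < 2 -> i' < 3 -> j' < 2 ->
    (t i' j' \in nbrs (t i j)) = (i != i').
  move=> i_lt j_lt i'_lt j'_lt; rewrite -(tE (Ordinal i_lt) (Ordinal j_lt)).
  by rewrite -(tE (Ordinal i'_lt) (Ordinal j'_lt)) -edge_idx g_edge.
(* Adjacency does not separate antipodes; injectivity of [g] does. *)
have t_neq i : i < 3 -> (t i 1 == t i 0) = false.
  move=> i_lt; rewrite -(tE (Ordinal i_lt) ord_max) -(tE (Ordinal i_lt) ord0).
  by rewrite (inj_eq idx_inj) (inj_eq g_inj) xpair_eqE andbF.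
have t00_lt : t 0 0 < 42 by rewrite -(tE ord0 ord0) idx_lt.
case: (@octahedron_list_complete (t 0 0) (t 0 1) (t 1 0) (t 1 1) (t 2 0) (t 2 1));
  rewrite ?t_edge ?t_neq //.
move=> s sL /allP t_s; exists s => // -[i j]; rewrite tE; apply: t_s.
(* The six arguments were given part by part, which is the order of this product list. *)
by apply: (allpairs_f t (s := iota 0 3) (t := iota 0 2)); rewrite mem_iota ltn_ord.
Qed.

Theorem theorem4p1 :
  connected G /\ kregular 12 G /\ #|G| = 42 /\ diameter G = 3 /\
  is_H1H2graph (complete 4) 42 4 K222 21 3 G /\
  (forall v : G, #|copies_at K222 v| = 3 /\ #|copies_at (complete 4) v| = 4).
Proof.
split; first exact: G_connected.
split; first exact: G_regular.
split; first exact: G_card.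
split; first exact: G_diameter.
split; last first.
  move=> v; split; [exact: (Hgraph_copies_at G_K222) | exact: (Hgraph_copies_at G_K4)].
split; [| exact: G_K4 | exact: G_K222].
(* The orders are 4 and 6. *)
by apply/negP => /isomorphic_card; rewrite card_prod !card_ord.
Qed.
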